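(* Let $\mathrm{L}\colon\mathbf{H}\to\mathbf{H}'$ be a functor between $\infty$-topoi which preserves geometric realisations (colimits of simplicial objects) and finite products. Suppose $G$ is a group object in $\mathbf{H}$. (1) $\mathrm{L}$ maps $G$-actions $P/\!/G\xrightarrow{p}B$ over $B\in\mathbf{H}$ to $\mathrm{L}G$-actions $\mathrm{L}P/\!/\mathrm{L}G\xrightarrow{\mathrm{L}p}\mathrm{L}B$ over $\mathrm{L}B\in\mathbf{H}'$. (2) If the action $P/\!/G\to B$ is a principal $G$-bundle, then the action $\mathrm{L}P/\!/\mathrm{L}G\xrightarrow{\mathrm{L}p}\mathrm{L}B$ is a principal $\mathrm{L}G$-bundle.
   Context: A groupoid object is a simplicial object $X$ such that for every $n\ge0$ and every $[n]=S\cup S'$ with $S\cap S'$ a single element, the square $X_n, X(S), X(S'), X_0$ is a pullback (with $X(S)=X_{|S|-1}$). A group object is a groupoid object $G$ with $G_0$ final; the spine decomposition identifies $G_n\simeq G_1^n$. $\mathrm{L}G$ denotes the levelwise image, which is a group object since $\mathrm{L}$ preserves finite products; likewise $\mathrm{L}P/\!/\mathrm{L}G$ denotes the levelwise image $\mathrm{L}(P/\!/G)$. An action of $G$ on $P$ is a simplicial object $P/\!/G$ such that (i) $(P/\!/G)_n=P\times G_1^n$; (ii) $d_1\colon P\times G_1\to P$ is the projection and $s_0\colon P\to P\times G_1$ is $1_P\times( *\xrightarrow{s_0}G_1)$; (iii) the collapse $P\to*$ induces a morphism $P/\!/G\to G$ of simplicial objects. Writing $a:=d_0\colon P\times G_1\to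 P$, for $n\ge1$ the face $d_0\colon P\times G_1^n\to P\times G_1^{n-1}$ is equivalent to $a\times1_{G_1^{n-1}}$ and $d_n$ is equivalent to the projection onto the first $n$ factors. A $G$-action over $B$ is an augmented simplicial object with augmenting object $B$ whose underlying simplicial object is a $G$-action $P/\!/G$; $p\colon P\to B$ is the degree-$0$ augmentation. It is a principal $G$-bundle ($G$-principal $\infty$-bundle) if the induced morphism $|P/\!/G|=\mathrm{colim}_{\Delta^{\mathrm{op}}}(P/\!/G)\to B$ is an equivalence. *)

(* Defs.v *)
(* Infinity-categories are quasi-categories: simplicial sets in which inner
   horns have fillers.  Functors are simplicial maps. *)
From Stdlib Require Import StrictProp.
From mathcomp Require Import all_boot boolp.

Set Implicit Arguments.
Unset Strict Implicit.
Unset Printing Implicit Defensive.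
Set Primitive Projections.

(** * Size *)

(* Simplicial sets have values in [Large]; [Small : Large] plays the role of
   the universe of small sets. *)
Definition Large := Type.
Definition Small : Large := Type.

Definition essentially_small (A : Large) : Prop :=
  exists (S : Small) (f : A -> S), bijective f.

Definition card_le (A B : Large) : Prop := exists f : A -> B, injective f.
Definition card_lt (A B : Large) : Prop := card_le A B /\ ~ card_le B A.

(* A small set standing for its cardinal, which is infinite and regular. *)
Definition regular_cardinal (k : Small) : Prop :=
  card_le nat k /\
  forall (I : Large) (J : I -> Large),
    card_lt I k -> (forall i, card_lt (J i) k) -> card_lt {i : I & J i} k.

(** * The category of finite ordinals *)

(* Boolean truth as a strict proposition: monotonicity proofs become
   definitionally irrelevant, so composition of monotone maps is
   definitionally associative and unital. *)
Definition sT (b : bool) : SProp := if b then sUnit else sEmpty.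

Lemma sTP (b : bool) : sT b -> b.
Proof. destruct b; [reflexivity | intros []]. Qed.

Definition Tsp (b : bool) : b -> sT b :=
  match b return b -> sT b with
  | true => fun=> stt
  | false => fun h => False_sind sEmpty (notF h)
  end.

Definition sT_trans i j k (h1 : sT (i <= j)) (h2 : sT (j <= k)) :
    sT (i <= k) :=
  Tsp (leq_trans (sTP h1) (sTP h2)).

Record ordmap (m n : nat) := OrdMap {
  omfun :> 'I_m -> 'I_n;
  ommono : forall i j : 'I_m, sT (i <= j) -> sT (omfun i <= omfun j) }.

Definition omid n : ordmap n n := @OrdMap n n (fun i => i) (fun i j h => h).

Definition omcomp m n p (g : ordmap n p) (f : ordmap m n) : ordmap m p :=
  @OrdMap m p (fun i => g (f i)) (fun i j h => ommono g (ommono f h)).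

Definition mkom m n (f : 'I_m -> 'I_n)
    (h : forall i j : 'I_m, i <= j -> f i <= f j) : ordmap m n :=
  @OrdMap m n f (fun i j le_ij => Tsp (h i j (sTP le_ij))).

Lemma ommonoP m n (f : ordmap m n) (i j : 'I_m) : i <= j -> f i <= f j.
Proof. exact (fun h => sTP (ommono f (Tsp h))). Qed.

Definition omcst m n (k : 'I_n) : ordmap m n :=
  @mkom m n (fun=> k) (fun _ _ _ => leqnn k).

Lemma lift_mono n (k : 'I_n.+1) (i j : 'I_n) : i <= j -> lift k i <= lift k j.
Proof. by rewrite /= leq_bump2. Qed.

(* The coface map whose image omits [k]. *)
Definition omface n (k : 'I_n.+1) : ordmap n n.+1 := mkom (@lift_mono n k).

Definition omempty n : ordmap 0 n :=
  @mkom 0 n (fun i => False_rect 'I_n (notF (ltn_ord i)))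
    (fun i _ _ => False_ind _ (notF (ltn_ord i))).

Lemma ommin_mono m (s t : ordmap m 2) (i j : 'I_m) : i <= j ->
  (if s i <= t i then s i else t i) <= (if s j <= t j then s j else t j).
Proof.
move=> h; have hs := ommonoP s h; have ht := ommonoP t h.
case: ifP => hi; case: ifP => // hj.
- exact: leq_trans hi ht.
- by apply: leq_trans hs; apply: ltnW; rewrite ltnNge hi.
Qed.

Definition ommin m (s t : ordmap m 2) : ordmap m 2 := mkom (@ommin_mono m s t).

Lemma rev_mono m n (f : ordmap m n) (i j : 'I_m) :
  i <= j -> rev_ord (f (rev_ord i)) <= rev_ord (f (rev_ord j)).
Proof.
move=> h; rewrite /=; apply: leq_sub2l; rewrite ltnS.
by apply: (ommonoP f); rewrite /= leq_sub2l.
Qed.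

Definition omrev m n (f : ordmap m n) : ordmap m n := mkom (@rev_mono m n f).

Lemma ordmap_eq m n (f g : ordmap m n) : omfun f = omfun g -> f = g.
Proof.
destruct f as [f hf], g as [g hg]; simpl; intros e; destruct e; reflexivity.
Qed.

(** * Simplicial sets *)

(* [m.+1] is the cardinal of the ordinal [m]; [sact x f] is the restriction
   of the simplex [x] along [f : [m] -> [n]]. *)
Record sset := SSet {
  sx :> nat -> Large;
  sact : forall m n, sx n -> ordmap m.+1 n.+1 -> sx m;
  sact_id : forall n (x : sx n), sact x (omid n.+1) = x;
  sact_comp : forall m n p (x : sx p) (g : ordmap n.+1 p.+1)
    (f : ordmap m.+1 n.+1), sact x (omcomp g f) = sact (sact x g) f }.
Arguments sact {s m n} x f.

Record smap (X Y : sset) := SMap {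
  smapfun :> forall n : nat, X n -> Y n;
  smap_nat : forall m n (x : X n) (f : ordmap m.+1 n.+1),
    @smapfun m (sact x f) = sact (@smapfun n x) f }.
Arguments smapfun {X Y} s n x.

Lemma smap_eq X Y (f g : smap X Y) : (forall n (x : X n), f n x = g n x) -> f = g.
Proof.
case: f => f hf; case: g => g hg /= e.
have {}e : f = g by apply: functional_extensionality_dep => n; exact/funext.
by case: _ / e hg => hg; rewrite (Prop_irrelevance hf hg).
Qed.

Definition sid X : smap X X := @SMap X X (fun n x => x) (fun _ _ _ _ => erefl).

Lemma scomp_nat X Y Z (g : smap Y Z) (f : smap X Y) m n (x : X n)
  (h : ordmap m.+1 n.+1) : g m (f m (sact x h)) = sact (g n (f n x)) h.
Proof. by rewrite !smap_nat. Qed.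

Definition scomp X Y Z (g : smap Y Z) (f : smap X Y) : smap X Z :=
  @SMap X Z (fun n x => g n (f n x)) (@scomp_nat X Y Z g f).

(** The standard simplex. *)
Definition simplex (n : nat) : sset :=
  @SSet (fun m => ordmap m.+1 n.+1) (fun _ _ x f => omcomp x f)
    (fun _ _ => erefl) (fun _ _ _ _ _ _ => erefl).

Definition simplex_map m n (f : ordmap m.+1 n.+1) :
    smap (simplex m) (simplex n) :=
  @SMap (simplex m) (simplex n) (fun _ x => omcomp f x) (fun _ _ _ _ => erefl).

(** Constant simplicial sets. *)
Definition disc (I : Large) : sset :=
  @SSet (fun=> I) (fun _ _ x _ => x) (fun _ _ => erefl)
    (fun _ _ _ _ _ _ => erefl).

Section Prod.
Variables X Y : sset.
Let act m n (x : X n * Y n) (f : ordmap m.+1 n.+1) : X m * Y m :=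
  (sact x.1 f, sact x.2 f).
Let act_id n (x : X n * Y n) : act x (omid n.+1) = x.
Proof. by rewrite /act !sact_id; case: x. Qed.
Let act_comp m n p (x : X p * Y p) (g : ordmap n.+1 p.+1)
  (f : ordmap m.+1 n.+1) : act x (omcomp g f) = act (act x g) f.
Proof. by rewrite /act !sact_comp. Qed.

Definition sprod : sset := @SSet (fun n => (X n * Y n)%type) act act_id act_comp.

Definition sfst : smap sprod X :=
  @SMap sprod X (fun _ x => x.1) (fun _ _ _ _ => erefl).
Definition ssnd : smap sprod Y :=
  @SMap sprod Y (fun _ x => x.2) (fun _ _ _ _ => erefl).
End Prod.

Definition spair X Y Z (f : smap Z X) (g : smap Z Y) : smap Z (sprod X Y) :=
  @SMap Z (sprod X Y) (fun n z => (f n z, g n z))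
    (fun _ _ z h => congr2 pair (smap_nat f z h) (smap_nat g z h)).

Definition sprod_map X Y X' Y' (f : smap X X') (g : smap Y Y') :
    smap (sprod X Y) (sprod X' Y') :=
  spair (scomp f (sfst X Y)) (scomp g (ssnd X Y)).

(** Simplicial subsets. *)
Section Sub.
Variables (X : sset) (P : forall n, X n -> Prop).
Hypothesis closed : forall m n (x : X n) (f : ordmap m.+1 n.+1),
  P x -> P (sact x f).
Let act m n (x : {x : X n | P x}) (f : ordmap m.+1 n.+1) : {x : X m | P x} :=
  exist _ (sact (sval x) f) (closed f (svalP x)).
Let act_id n (x : {x : X n | P x}) : act x (omid n.+1) = x.
Proof. by case: x => x hx; apply: eq_exist; exact: sact_id. Qed.
Let act_comp m n p (x : {x : X p | P x}) (g : ordmap n.+1 p.+1)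
  (f : ordmap m.+1 n.+1) : act x (omcomp g f) = act (act x g) f.
Proof. by apply: eq_exist; exact: sact_comp. Qed.

Definition ssub : sset := @SSet (fun n => {x : X n | P x}) act act_id act_comp.

Definition sincl : smap ssub X :=
  @SMap ssub X (fun _ x => sval x) (fun _ _ _ _ => erefl).
End Sub.

Definition in_boundary m n (f : ordmap m n) : Prop :=
  exists j : 'I_n, forall i, f i <> j.
Definition in_horn m n (k : 'I_n) (f : ordmap m n) : Prop :=
  exists2 j : 'I_n, j <> k & forall i, f i <> j.

Definition boundary (n : nat) : sset.
Proof.
apply: (@ssub (simplex n) (fun m f => in_boundary f)).
by move=> m p x f [j hj]; exists j => i; exact: hj.
Defined.

Definition horn (n : nat) (k : 'I_n.+1) : sset.
Proof.
apply: (@ssub (simplex n) (fun m f => in_horn k f)).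
by move=> m p x f [j jk hj]; exists j => // i; exact: hj.
Defined.

(* By the Yoneda lemma a map out of the standard simplex is a simplex. *)
Definition fills (X A : sset) n (i : smap A (simplex n)) (a : smap A X)
    (x : X n) : Prop :=
  forall m (t : A m), sact x (i m t) = a m t.

Definition quasicategory (C : sset) : Prop :=
  forall n (k : 'I_n.+1), 0 < k < n -> forall a : smap (horn k) C,
  exists x : C n, fills (sincl _) a x.

Definition small_sset (K : sset) : Prop := forall n, essentially_small (K n).

(* For an infinite cardinal: fewer than [k] non-degenerate simplices. *)
Definition card_small (k : Large) (K : sset) : Prop :=
  exists (I : Large) (d : I -> nat) (x : forall i, K (d i)),
    card_lt I k /\
    forall n (y : K n), exists i (f : ordmap n.+1 (d i).+1), y = sact (x i) f.

Definition finite_sset (K : sset) : Prop := card_small nat K.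

(** The opposite simplicial set. *)
Section Opp.
Variable X : sset.
Let act m n (x : X n) (f : ordmap m.+1 n.+1) : X m := sact x (omrev f).
Let act_id n (x : X n) : act x (omid n.+1) = x.
Proof.
rewrite /act -[RHS]sact_id; congr sact.
by apply/ordmap_eq/funext => i; exact: rev_ordK.
Qed.
Let act_comp m n p (x : X p) (g : ordmap n.+1 p.+1)
  (f : ordmap m.+1 n.+1) : act x (omcomp g f) = act (act x g) f.
Proof.
rewrite /act -sact_comp; congr sact.
by apply/ordmap_eq/funext => i; rewrite /= rev_ordK.
Qed.
Definition sopp : sset := @SSet X act act_id act_comp.
End Opp.

(** The simplicial set of maps; for a quasi-category [C] it is the
    infinity-category of functors. *)
Section Fun.
Variables K C : sset.
Let act m n (x : smap (sprod K (simplex n)) C) (f : ordmap m.+1 n.+1) :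
    smap (sprod K (simplex m)) C :=
  scomp x (sprod_map (sid K) (simplex_map f)).
Let act_id n (x : smap (sprod K (simplex n)) C) : act x (omid n.+1) = x.
Proof. by apply: smap_eq => m [k t]. Qed.
Let act_comp m n p (x : smap (sprod K (simplex p)) C) (g : ordmap n.+1 p.+1)
  (f : ordmap m.+1 n.+1) : act x (omcomp g f) = act (act x g) f.
Proof. by apply: smap_eq => q [k t]. Qed.

Definition Fun : sset :=
  @SSet (fun n => smap (sprod K (simplex n)) C) act act_id act_comp.

(* A map, as a vertex of [Fun]. *)
Definition fob (F : smap K C) : Fun 0 := scomp F (sfst _ _).
End Fun.

Definition postcomp K C D (F : smap C D) n (e : Fun K C n) : Fun K D n :=
  scomp F e.
Definition precomp J K C (G : smap J K) n (e : Fun K C n) : Fun J C n :=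
  scomp e (sprod_map G (sid _)).

(** * Edges of a quasi-category *)

Section Edges.
Variable C : sset.

Definition src (e : C 1) : C 0 := sact e (omface (@Ordinal 2 1 isT)).
Definition tgt (e : C 1) : C 0 := sact e (omface (@Ordinal 2 0 isT)).
Definition idedge (x : C 0) : C 1 := sact x (omcst 2 ord0).

(* [h] is a composite of [f] followed by [g]. *)
Definition composite (f g h : C 1) : Prop :=
  exists s : C 2,
    [/\ sact s (omface (@Ordinal 3 2 isT)) = f,
        sact s (omface (@Ordinal 3 0 isT)) = g &
        sact s (omface (@Ordinal 3 1 isT)) = h].

Definition homotopic (f g : C 1) : Prop := composite f (idedge (tgt f)) g.

Definition equivalence (f : C 1) : Prop :=
  exists2 g, composite f g (idedge (src f)) & composite g f (idedge (tgt f)).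

(* Every sphere whose first, resp. last, vertex is [x] can be filled. *)
Definition initial (x : C 0) : Prop :=
  forall n (a : smap (boundary n.+1) C),
    (forall v : boundary n.+1 0, sval v ord0 = ord0 -> a 0 v = x) ->
    exists y : C n.+1, fills (sincl _) a y.
Definition final (x : C 0) : Prop :=
  forall n (a : smap (boundary n.+1) C),
    (forall v : boundary n.+1 0, sval v ord0 = ord_max -> a 0 v = x) ->
    exists y : C n.+1, fills (sincl _) a y.
End Edges.

(** Mapping spaces. *)

Definition cst0 m : ordmap m 2 := omcst m ord0.
Definition cst1 m : ordmap m 2 := omcst m ord_max.
Definition ptmap m : ordmap m.+1 1 := omcst m.+1 ord0.

Definition hom (C : sset) (x y : C 0) : sset.
Proof.
apply: (@ssub (Fun (simplex 1) C) (fun n (h : Fun (simplex 1) C n) =>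
  forall m (t : simplex n m), h m (cst0 m.+1, t) = sact x (ptmap m) /\
                              h m (cst1 m.+1, t) = sact y (ptmap m))).
by move=> m n h f hh p t; exact: hh.
Defined.

Section HomMap.
Variables (C D : sset) (F : smap C D) (x y : C 0).
Let F1 n (h : hom x y n) : hom (F 0 x) (F 0 y) n.
Proof.
exists (postcomp F (sval h)) => m t.
by rewrite /= (svalP h m t).1 (svalP h m t).2 !smap_nat.
Defined.
Let F1_nat m n (h : hom x y n) (f : ordmap m.+1 n.+1) :
  F1 (sact h f) = sact (F1 h) f.
Proof. by apply: eq_exist; exact: smap_eq. Qed.

Definition hom_map : smap (hom x y) (hom (F 0 x) (F 0 y)) :=
  @SMap (hom x y) (hom (F 0 x) (F 0 y)) F1 F1_nat.
End HomMap.

Definition shomotopic (A B : sset) (f g : smap A B) : Prop :=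
  exists2 e : Fun A B 1, src e = fob f & tgt e = fob g.

Definition homotopy_equivalence (A B : sset) (f : smap A B) : Prop :=
  exists g : smap B A,
    shomotopic (scomp g f) (sid A) /\ shomotopic (scomp f g) (sid B).

Definition fully_faithful (C D : sset) (F : smap C D) : Prop :=
  forall x y : C 0, homotopy_equivalence (hom_map F x y).

(** * Limits and colimits *)

(* [coslice p] and [slice p] are the (fat) slices C^{p/} and C^{/p}: an
   [n]-simplex is an [n]-simplex [y] of [C] together with a map
   [h : (K * Delta^1) * Delta^n -> C] which is [p] at one end of [Delta^1] and
   [y] at the other (Lurie, Higher Topos Theory, 4.2.1).  A vertex is a cocone, resp. a cone, i.e. a natural
   transformation between [p] and a constant map. *)
Section Cones.
Variables (K C : sset) (p : smap K C).
Let T := sprod C (Fun (sprod K (simplex 1)) C).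

Definition coslice : sset.
Proof.
apply: (@ssub T (fun n (c : T n) => forall m (k : K m) (t : simplex n m),
  c.2 m ((k, cst0 m.+1), t) = p m k /\
  c.2 m ((k, cst1 m.+1), t) = sact c.1 t)).
by move=> m n c f hc q k t /=; rewrite -sact_comp; exact: hc.
Defined.

Definition slice : sset.
Proof.
apply: (@ssub T (fun n (c : T n) => forall m (k : K m) (t : simplex n m),
  c.2 m ((k, cst0 m.+1), t) = sact c.1 t /\
  c.2 m ((k, cst1 m.+1), t) = p m k)).
by move=> m n c f hc q k t /=; rewrite -sact_comp; exact: hc.
Defined.

Definition cocone_is (c : coslice 0) (y : C 0) (h : smap (sprod K (simplex 1)) C) :=
  sval c = (y, fob h).
Definition cone_is (c : slice 0) (y : C 0) (h : smap (sprod K (simplex 1)) C) :=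
  sval c = (y, fob h).

Definition colimit_cocone (c : coslice 0) : Prop := initial c.
Definition limit_cone (c : slice 0) : Prop := final c.
End Cones.

Section CosliceMap.
Variables (K C D : sset) (F : smap C D) (p : smap K C).
Let F1 n (c : coslice p n) : coslice (scomp F p) n.
Proof.
exists (F n (sval c).1, postcomp F (sval c).2) => m k t.
by rewrite /= (svalP c m k t).1 (svalP c m k t).2 !smap_nat.
Defined.
Let F1_nat m n (c : coslice p n) (f : ordmap m.+1 n.+1) :
  F1 (sact c f) = sact (F1 c) f.
Proof.
apply: eq_exist; rewrite /= smap_nat; congr pair; exact: smap_eq.
Qed.

Definition coslice_map : smap (coslice p) (coslice (scomp F p)) :=
  @SMap (coslice p) (coslice (scomp F p)) F1 F1_nat.
End CosliceMap.

Section SliceMap.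
Variables (K C D : sset) (F : smap C D) (p : smap K C).
Let F1 n (c : slice p n) : slice (scomp F p) n.
Proof.
exists (F n (sval c).1, postcomp F (sval c).2) => m k t.
by rewrite /= (svalP c m k t).1 (svalP c m k t).2 !smap_nat.
Defined.
Let F1_nat m n (c : slice p n) (f : ordmap m.+1 n.+1) :
  F1 (sact c f) = sact (F1 c) f.
Proof.
apply: eq_exist; rewrite /= smap_nat; congr pair; exact: smap_eq.
Qed.

Definition slice_map : smap (slice p) (slice (scomp F p)) :=
  @SMap (slice p) (slice (scomp F p)) F1 F1_nat.
End SliceMap.

Definition preserves_colimits K C D (F : smap C D) : Prop :=
  forall (p : smap K C) (c : coslice p 0),
    colimit_cocone c -> colimit_cocone (coslice_map F p 0 c).
Definition preserves_limits K C D (F : smap C D) : Prop :=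
  forall (p : smap K C) (c : slice p 0),
    limit_cone c -> limit_cone (slice_map F p 0 c).
Arguments preserves_colimits K {C D} F.
Arguments preserves_limits K {C D} F.

Definition preserves_finite_products C D (F : smap C D) : Prop :=
  forall I : finType, preserves_limits (disc I) F.

Definition left_exact C D (F : smap C D) : Prop :=
  forall K, finite_sset K -> preserves_limits K F.

Definition filtered (k : Large) (D : sset) : Prop :=
  quasicategory D /\
  forall K, card_small k K -> forall p : smap K D, inhabited (coslice p 0).

Definition accessible_functor C D (F : smap C D) : Prop :=
  exists2 k : Small, regular_cardinal k &
    forall K, small_sset K -> filtered k K -> preserves_colimits K F.

(* The edges [e i : x -> y i] exhibit [x] as a product of the [y i]. *)
Definition is_product (C : sset) (I : finType) (x : C 0) (y : I -> C 0)
    (e : I -> C 1) : Prop :=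
  exists (p : smap (disc I) C) (h : smap (sprod (disc I) (simplex 1)) C)
         (c : slice p 0),
    [/\ forall i, p 0 i = y i, forall i, h 1 (i, omid 2) = e i,
        cone_is c x h & limit_cone c].

(** Pullback squares. *)

(* The cospan (1,0) -> (1,1) <- (0,1) inside [Delta^1 * Delta^1]. *)
Definition cospan : sset.
Proof.
apply: (@ssub (sprod (simplex 1) (simplex 1))
  (fun n (st : ordmap n.+1 2 * ordmap n.+1 2) =>
     forall i, st.1 i = ord_max \/ st.2 i = ord_max)).
by move=> m n x f hx i; exact: hx.
Defined.

(* The map cospan * Delta^1 -> Delta^1 * Delta^1 which is constant at (0,0) on
   cospan * {0} and the inclusion on cospan * {1}. *)
Definition cospan_cone :
    smap (sprod cospan (simplex 1)) (sprod (simplex 1) (simplex 1)) :=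
  @SMap (sprod cospan (simplex 1)) (sprod (simplex 1) (simplex 1))
    (fun n stu => (ommin (sval stu.1).1 stu.2, ommin (sval stu.1).2 stu.2))
    (fun _ _ _ _ => erefl).

Definition is_pullback (C : sset) (q : smap (sprod (simplex 1) (simplex 1)) C) :
    Prop :=
  exists c : slice (scomp q (sincl _ : smap cospan _)) 0,
    cone_is c (q 0 (cst0 1, cst0 1)) (scomp q cospan_cone) /\ limit_cone c.

(** * The infinity-category of spaces, presheaves, infinity-topoi *)

(* An [n]-simplex of the infinity-category of spaces is a left fibration with
   small fibres over [Delta^n], presented (so that pulling back is strictly
   functorial) as a presheaf of small sets on the category of simplices of
   [Delta^n].  The field [splift] is the left lifting condition: a section
   over the horn, above a simplex [g] of [Delta^n], extends to [g]. *)
Record space_simplex (n : nat) : Large := SpaceSimplex {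
  spfib : forall m, ordmap m.+1 n.+1 -> Small;
  spres : forall m k (g : ordmap k.+1 n.+1) (f : ordmap m.+1 k.+1),
    spfib g -> spfib (omcomp g f);
  spres_id : forall m (g : ordmap m.+1 n.+1) (a : spfib g),
    spres (omid m.+1) a = a;
  spres_comp : forall l m k (g : ordmap k.+1 n.+1) (f : ordmap m.+1 k.+1)
    (f' : ordmap l.+1 m.+1) (a : spfib g),
    spres (omcomp f f') a = spres f' (spres f a);
  splift : forall m (k : 'I_m.+1), k < m -> forall (g : ordmap m.+1 n.+1)
    (a : forall j (f : ordmap j.+1 m.+1), in_horn k f -> spfib (omcomp g f)),
    (forall j j' (f : ordmap j.+1 m.+1) (f' : ordmap j'.+1 j.+1)
       (h : in_horn k f) (h' : in_horn k (omcomp f f')),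
       spres f' (a j f h) = a j' (omcomp f f') h') ->
    exists x : spfib g, forall j (f : ordmap j.+1 m.+1) (h : in_horn k f),
      spres f x = a j f h }.

Definition space_act m n (A : space_simplex n) (r : ordmap m.+1 n.+1) :
    space_simplex m :=
  @SpaceSimplex m (fun k g => @spfib n A k (omcomp r g))
    (fun l k g f a => @spres n A l k (omcomp r g) f a)
    (fun k g a => @spres_id n A k (omcomp r g) a)
    (fun l k k' g f f' a => @spres_comp n A l k k' (omcomp r g) f f' a)
    (fun l k kl g a => @splift n A l k kl (omcomp r g) a).

Definition spaces : sset :=
  @SSet space_simplex space_act (fun _ _ => erefl) (fun _ _ _ _ _ _ => erefl).

Definition presheaves (D : sset) : sset := Fun (sopp D) spaces.

(* Unit, counit, and the triangle identities up to homotopy. *)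
Definition adjunction C D (L : smap C D) (R : smap D C) : Prop :=
  exists (eta : Fun C C 1) (eps : Fun D D 1),
    [/\ src eta = fob (sid C) /\ tgt eta = fob (scomp R L),
        src eps = fob (scomp L R) /\ tgt eps = fob (sid D),
        composite (postcomp L eta) (precomp L eps) (idedge (fob L)) &
        composite (precomp R eta) (postcomp R eps) (idedge (fob R))].

(* An infinity-topos is an accessible left exact localization of the
   infinity-category of presheaves on a small infinity-category: [L] is left
   exact, and its right adjoint [R] is fully faithful and accessible. *)
Definition infinity_topos (X : sset) : Prop :=
  quasicategory X /\
  exists D : sset, [/\ quasicategory D, small_sset D &
    exists (L : smap (presheaves D) X) (R : smap X (presheaves D)),
      [/\ adjunction L R, fully_faithful R, left_exact L &
          accessible_functor R]].

(** * Nerves and simplicial objects *)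

Record cat := Cat {
  Ob : Large;
  Hom : Ob -> Ob -> Large;
  idc : forall x, Hom x x;
  cmp : forall x y z, Hom y z -> Hom x y -> Hom x z;
  cmp_idl : forall x y (f : Hom x y), cmp (idc y) f = f;
  cmp_idr : forall x y (f : Hom x y), cmp f (idc x) = f;
  cmpA : forall x y z w (h : Hom z w) (g : Hom y z) (f : Hom x y),
    cmp h (cmp g f) = cmp (cmp h g) f }.
Arguments cmp {c x y z} g f.
Arguments idc {c} x.

(* Functors from the ordered set [n] to [A]. *)
Record chain (A : cat) (n : nat) := Chain {
  cob : 'I_n.+1 -> Ob A;
  chom : forall i j : 'I_n.+1, sT (i <= j) -> Hom (cob i) (cob j);
  chom_id : forall (i : 'I_n.+1) (h : sT (i <= i)), chom h = idc (cob i);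
  chom_cmp : forall (i j k : 'I_n.+1) (h : sT (i <= j)) (h' : sT (j <= k)),
    chom (sT_trans h h') = cmp (chom h') (chom h) }.
Arguments chom {A n} c {i j} h.

Definition chain_act A m n (c : chain A n) (f : ordmap m.+1 n.+1) : chain A m :=
  @Chain A m (fun i => cob c (f i)) (fun i j h => chom c (ommono f h))
    (fun i h => chom_id c (ommono f h))
    (fun i j k h h' => chom_cmp c (ommono f h) (ommono f h')).

Definition nerve (A : cat) : sset :=
  @SSet (chain A) (@chain_act A) (fun _ _ => erefl) (fun _ _ _ _ _ _ => erefl).

(* The object [n] stands for the ordinal [n], of cardinal [n.+1]. *)
Definition DeltaOp : cat :=
  @Cat nat (fun m n => ordmap n.+1 m.+1) (fun n => omid n.+1)
    (fun x y z g f => omcomp f g) (fun _ _ _ => erefl) (fun _ _ _ => erefl)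
    (fun _ _ _ _ _ _ _ => erefl).

(* The object [n] stands for the ordinal [n-1], of cardinal [n]. *)
Definition DeltaPlusOp : cat :=
  @Cat nat (fun m n => ordmap n m) (fun n => omid n)
    (fun x y z g f => omcomp f g) (fun _ _ _ => erefl) (fun _ _ _ => erefl)
    (fun _ _ _ _ _ _ _ => erefl).

(** Vertices, edges and squares of a nerve. *)

Definition pos_mono (s t : nat) (h : sT (s <= t)) : sT ((0 < s) ==> (0 < t)) :=
  Tsp (introT implyP (fun s0 => leq_trans s0 (sTP h))).

Definition vertex (A : cat) (x : Ob A) : nerve A 0 :=
  @Chain A 0 (fun=> x) (fun _ _ _ => idc x) (fun _ _ => erefl)
    (fun _ _ _ _ _ => esym (cmp_idl (idc x))).

Section Arrow.
Variables (A : cat) (x y : Ob A) (f : Hom x y).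
Definition arrow_ob (s : bool) : Ob A := if s then y else x.
Definition arrow_hom (s s' : bool) :
    sT (s ==> s') -> Hom (arrow_ob s) (arrow_ob s') :=
  match s, s' with
  | false, false => fun=> idc x
  | false, true => fun=> f
  | true, false => fun h => sEmpty_rect (fun=> Hom y x) h
  | true, true => fun=> idc y
  end.

Lemma arrow_hom_id s (h : sT (s ==> s)) : arrow_hom h = idc (arrow_ob s).
Proof. destruct s; reflexivity. Qed.

Lemma arrow_hom_cmp s s' s'' (h : sT (s ==> s')) (h' : sT (s' ==> s''))
    (h'' : sT (s ==> s'')) :
  arrow_hom h'' = cmp (arrow_hom h') (arrow_hom h).
Proof.
destruct s, s', s''; simpl; try (destruct h); try (destruct h');
  rewrite ?cmp_idl ?cmp_idr; reflexivity.
Qed.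

Definition arrow : nerve A 1 :=
  @Chain A 1 (fun i => arrow_ob (0 < i)) (fun i j h => arrow_hom (pos_mono h))
    (fun i h => arrow_hom_id (pos_mono h))
    (fun i j k h h' => arrow_hom_cmp (pos_mono h) (pos_mono h')
                         (pos_mono (sT_trans h h'))).
End Arrow.

Section Square.
Variables (A : cat) (x y z w : Ob A).
Variables (f : Hom x y) (g : Hom x z) (h : Hom y w) (k : Hom z w).
Hypothesis comm : cmp h f = cmp k g.

Definition square_ob (s t : bool) : Ob A :=
  match s, t with
  | false, false => x
  | true, false => y
  | false, true => z
  | true, true => w
  end.

Definition square_hom (s t s' t' : bool) : sT (s ==> s') -> sT (t ==> t') ->
    Hom (square_ob s t) (square_ob s' t') :=
  match s, s', t, t' with
  | true, false, _, _ => fun a _ => sEmpty_rect (fun=> Hom _ _) a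
  | _, _, true, false => fun _ a => sEmpty_rect (fun=> Hom _ _) a
  | false, false, false, false => fun _ _ => idc x
  | false, false, false, true => fun _ _ => g
  | false, false, true, true => fun _ _ => idc z
  | false, true, false, false => fun _ _ => f
  | false, true, false, true => fun _ _ => cmp h f
  | false, true, true, true => fun _ _ => k
  | true, true, false, false => fun _ _ => idc y
  | true, true, false, true => fun _ _ => h
  | true, true, true, true => fun _ _ => idc w
  end.

Lemma square_hom_id s t (a : sT (s ==> s)) (b : sT (t ==> t)) :
  square_hom a b = idc (square_ob s t).
Proof. destruct s, t; reflexivity. Qed.

Lemma square_hom_cmp s t s' t' s'' t'' (a : sT (s ==> s')) (b : sT (t ==> t'))
    (a' : sT (s' ==> s'')) (b' : sT (t' ==> t''))
    (a'' : sT (s ==> s'')) (b'' : sT (t ==> t'')) :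
  square_hom a'' b'' = cmp (square_hom a' b') (square_hom a b).
Proof.
destruct s, s', s''; try (destruct a); try (destruct a');
  destruct t, t', t''; try (destruct b); try (destruct b');
  simpl; rewrite ?cmp_idl ?cmp_idr; first [reflexivity | exact comm].
Qed.

Definition square_chain n (st : sprod (simplex 1) (simplex 1) n) : chain A n :=
  @Chain A n (fun i => square_ob (0 < st.1 i) (0 < st.2 i))
    (fun i j u => square_hom (pos_mono (ommono st.1 u))
                             (pos_mono (ommono st.2 u)))
    (fun i u => square_hom_id (pos_mono (ommono st.1 u))
                              (pos_mono (ommono st.2 u)))
    (fun i j k u v => square_hom_cmp
       (pos_mono (ommono st.1 u)) (pos_mono (ommono st.2 u))
       (pos_mono (ommono st.1 v)) (pos_mono (ommono st.2 v))
       (pos_mono (ommono st.1 (sT_trans u v)))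
       (pos_mono (ommono st.2 (sT_trans u v)))).

(* The commutative square
     x --f--> y
     |g       |h
     z --k--> w   with [y] at the vertex (1,0) and [z] at (0,1). *)
Definition square : smap (sprod (simplex 1) (simplex 1)) (nerve A) :=
  @SMap (sprod (simplex 1) (simplex 1)) (nerve A) square_chain
    (fun _ _ _ _ => erefl).
End Square.

(** Simplicial and augmented simplicial objects. *)

Definition simplicial_object (C : sset) := smap (nerve DeltaOp) C.
Definition augmented_object (C : sset) := smap (nerve DeltaPlusOp) C.

Section Collapse.
Definition collapse_card (t : bool) (n : nat) : nat := if t then 0 else n.+1.

Definition collapse_hom (t t' : bool) (m n : nat) :
    sT (t ==> t') -> ordmap n.+1 m.+1 ->
    ordmap (collapse_card t' n) (collapse_card t m) :=
  match t, t' with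
  | false, false => fun _ f => f
  | false, true => fun _ _ => omempty m.+1
  | true, false => fun h _ => sEmpty_rect (fun=> ordmap n.+1 0) h
  | true, true => fun _ _ => omid 0
  end.

Arguments collapse_hom {t t' m n}.

Lemma collapse_hom_id t n (h : sT (t ==> t)) :
  collapse_hom h (omid n.+1) = omid (collapse_card t n).
Proof. destruct t; reflexivity. Qed.

Lemma ordmap0_eq n (f g : ordmap 0 n) : f = g.
Proof. by apply/ordmap_eq/funext => -[]. Qed.

Lemma collapse_hom_cmp s t u m n p (h : sT (s ==> t)) (h' : sT (t ==> u))
    (h'' : sT (s ==> u)) (f : ordmap n.+1 m.+1) (g : ordmap p.+1 n.+1) :
  collapse_hom h'' (omcomp f g) = omcomp (collapse_hom h f) (collapse_hom h' g).
Proof.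
destruct s, t, u; try (destruct h); try (destruct h');
  first [reflexivity | apply ordmap0_eq].
Qed.

Definition collapse_chain n (ct : sprod (nerve DeltaOp) (simplex 1) n) :
    chain DeltaPlusOp n :=
  @Chain DeltaPlusOp n (fun i => collapse_card (0 < ct.2 i) (cob ct.1 i))
    (fun i j u => collapse_hom (pos_mono (ommono ct.2 u)) (chom ct.1 u))
    (fun i u => etrans
       (congr1 (collapse_hom (pos_mono (ommono ct.2 u))) (chom_id ct.1 u))
       (collapse_hom_id _ (pos_mono (ommono ct.2 u))))
    (fun i j k u v => etrans
       (congr1 (collapse_hom (pos_mono (ommono ct.2 (sT_trans u v))))
          (chom_cmp ct.1 u v))
       (collapse_hom_cmp (pos_mono (ommono ct.2 u)) (pos_mono (ommono ct.2 v))
          (pos_mono (ommono ct.2 (sT_trans u v)))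
          (chom ct.1 u) (chom ct.1 v))).

(* The functor DeltaOp * [1] -> DeltaPlusOp which is the inclusion at 0 and
   constant at the initial ordinal [-1] of Delta_+ at 1.  It identifies the
   nerve of DeltaPlusOp with the right cone on the nerve of DeltaOp. *)
Definition collapse : smap (sprod (nerve DeltaOp) (simplex 1)) (nerve DeltaPlusOp) :=
  @SMap (sprod (nerve DeltaOp) (simplex 1)) (nerve DeltaPlusOp) collapse_chain
    (fun _ _ _ _ => erefl).
End Collapse.

Definition inclusion_chain n (c : chain DeltaOp n) : chain DeltaPlusOp n :=
  @Chain DeltaPlusOp n (fun i => (cob c i).+1) (fun i j h => chom c h)
    (fun i h => chom_id c h) (fun i j k h h' => chom_cmp c h h').

Definition inclusion : smap (nerve DeltaOp) (nerve DeltaPlusOp) :=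
  @SMap (nerve DeltaOp) (nerve DeltaPlusOp) inclusion_chain
    (fun _ _ _ _ => erefl).

Section SimplicialObjects.
Variable C : sset.

(* [X_n] and, for [f : [m] -> [n]], the edge [X(f) : X_n -> X_m]. *)
Definition lev (X : simplicial_object C) (n : nat) : C 0 :=
  X 0 (@vertex DeltaOp n).
Definition edg (X : simplicial_object C) m n (f : ordmap m.+1 n.+1) : C 1 :=
  X 1 (@arrow DeltaOp n m f).

(* [d_k : X_(n+1) -> X_n] and [s_0 : X_0 -> X_1] *)
Definition fac (X : simplicial_object C) n (k : 'I_n.+2) : C 1 :=
  edg X (@omface n.+1 k).
Definition deg0 (X : simplicial_object C) : C 1 := edg X (ptmap 1).

(* An augmented object [Y]: its underlying simplicial object, the augmenting
   object, the augmentation in degree 0, and the resulting cocone. *)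
Definition underlying (Y : augmented_object C) : simplicial_object C :=
  scomp Y inclusion.
Definition augmenting (Y : augmented_object C) : C 0 :=
  Y 0 (@vertex DeltaPlusOp 0).
Definition augmentation (Y : augmented_object C) : C 1 :=
  Y 1 (@arrow DeltaPlusOp 1 0 (omempty 1)).

(* The subsets S and S' of [n] are the images of the injective monotone maps
   [a : [p] -> [n]] and [b : [q] -> [n]]. *)
Definition groupoid_object (X : simplicial_object C) : Prop :=
  forall n p q (a : ordmap p.+1 n.+1) (b : ordmap q.+1 n.+1)
    (u : ordmap 1 p.+1) (v : ordmap 1 q.+1) (e : omcomp a u = omcomp b v),
    injective a -> injective b ->
    (forall k, (exists i, a i = k) \/ (exists j, b j = k)) ->
    (forall i j, a i = b j -> i = u ord0 /\ j = v ord0) ->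
    is_pullback (scomp X (@square DeltaOp n p q 0 a b u v e)).

Definition group_object (G : simplicial_object C) : Prop :=
  groupoid_object G /\ final (lev G 0).

End SimplicialObjects.

Lemma spine_subproof n (i : 'I_n) (j : 'I_2) : i + j < n.+1.
Proof.
have hi := ltn_ord i; have hj : j <= 1 by rewrite -ltnS.
by rewrite ltnS; apply: leq_trans (leq_add (leqnn i) hj) _; rewrite addn1.
Qed.

Lemma spine_mono n (i : 'I_n) (j k : 'I_2) : j <= k ->
  Ordinal (spine_subproof i j) <= Ordinal (spine_subproof i k).
Proof. by rewrite /= leq_add2l. Qed.

(* The inclusion of the edge {i, i+1} into the ordinal [n]. *)
Definition spine n (i : 'I_n) : ordmap 2 n.+1 := mkom (@spine_mono n i).

(** * Group actions and principal bundles *)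

(* [pr n] and [q n i] are the projections of the product
   (P//G)_n = P * G_1^n onto P and onto its [i]-th factor G_1, and [phi] is the
   morphism P//G -> G induced by P -> *: its component in degree [n] is the
   projection P * G_1^n -> G_1^n, where G_1^n is identified with G_n by the
   spine.  The equality (P//G)_n = P * G_1^n stands for the identification given
   by the face maps and the morphism to G, and not for an unrelated levelwise
   equivalence; the last four fields say so. *)
Record action_data (C : sset) (G : simplicial_object C) (P : C 0)
    (X : simplicial_object C) (pr : nat -> C 1) (q : forall n, 'I_n -> C 1)
    (phi : Fun (nerve DeltaOp) C 1) : Prop := ActionData {
  act_lev0 : lev X 0 = P;
  act_pr0 : pr 0 = idedge P;
  act_prod : forall n,
    is_product (lev X n)
      (fun i : option 'I_n => if i is None then P else lev G 1)
      (fun i : option 'I_n => if i is Some j then q n j else pr n);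
  act_d1 : homotopic (fac X (@Ordinal 2 1 isT)) (pr 1);
  (* s_0 is 1_P times the composite P -> G_0 -> G_1 *)
  act_s0_pr : composite (deg0 X) (pr 1) (idedge P);
  act_s0_q : exists t w : C 1,
    [/\ src t = P, tgt t = lev G 0, composite t (deg0 G) w &
        composite (deg0 X) (q 1 ord0) w];
  act_phi_src : src phi = fob X;
  act_phi_tgt : tgt phi = fob G;
  act_phi : forall n (i : 'I_n),
    composite (phi 1 (idedge (@vertex DeltaOp n : nerve DeltaOp 0), omid 2))
      (edg G (spine i)) (q n i);
  (* d_(n+1) is the projection onto the first factors *)
  act_dlast_pr : forall n, composite (fac X (@ord_max n.+1)) (pr n) (pr n.+1);
  act_dlast_q : forall n (i : 'I_n),
    composite (fac X (@ord_max n.+1)) (q n i) (q n.+1 (widen_ord (leqnSn n) i));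
  (* d_0 is a * 1, with [a := d_0 : P * G_1 -> P] and [r] the projection of
     P * G_1^(n+1) onto P * G_1 *)
  act_d0_pr : forall n, exists r w : C 1,
    [/\ composite r (pr 1) (pr n.+1), composite r (q 1 ord0) (q n.+1 ord0),
        composite r (fac X (@Ordinal 2 0 isT)) w &
        composite (fac X (@ord0 n.+1)) (pr n) w];
  act_d0_q : forall n (i : 'I_n),
    composite (fac X (@ord0 n.+1)) (q n i) (q n.+1 (lift ord0 i)) }.

(* [X] is an action of the group object [G] on [P]. *)
Definition is_action (C : sset) (G : simplicial_object C) (P : C 0)
    (X : simplicial_object C) : Prop :=
  group_object G /\ exists pr q phi, @action_data C G P X pr q phi.

(* [Y] is a [G]-action P//G -> B over [B], with [p : P -> B] its augmentation in
   degree 0. *)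
Definition is_action_over (C : sset) (G : simplicial_object C) (P B : C 0)
    (p : C 1) (Y : augmented_object C) : Prop :=
  [/\ is_action G P (underlying Y), augmenting Y = B & augmentation Y = p].

(* The morphism from the colimit of the underlying simplicial object to the
   augmenting object is an equivalence: [c] is a colimit cocone, and [e] is a
   morphism of cocones from [c] to the augmentation. *)
Definition realisation_equivalence (C : sset) (Y : augmented_object C) : Prop :=
  exists (c b : coslice (underlying Y) 0) (e : coslice (underlying Y) 1),
    [/\ colimit_cocone c,
        cocone_is b (augmenting Y) (scomp Y collapse),
        src e = c, tgt e = b & equivalence (sval e).1].

Definition is_principal_bundle (C : sset) (G : simplicial_object C) (P B : C 0)
    (p : C 1) (Y : augmented_object C) : Prop :=
  is_action_over G P B p Y /\ realisation_equivalence Y.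

Definition preserves_geometric_realisations C D (F : smap C D) : Prop :=
  preserves_colimits (nerve DeltaOp) F.

(* Main.v *)
Require Import Defs.
From mathcomp Require Import all_boot boolp.

Set Implicit Arguments.
Unset Strict Implicit.
Unset Printing Implicit Defensive.

(** A functor of quasi-categories is a simplicial map, so composites,
    homotopies and equivalences are carried along by functoriality, and the
    product decompositions and colimit cocones of an action or a bundle are
    preserved by hypothesis.  The one point with content is that [L G] is again
    a group object: the squares of a groupoid object are pullbacks, and [L] is
    not assumed to preserve pullbacks.  As [G_0] is final, however, these are
    pullbacks over a final object, that is, products, and [L] preserves both
    finite products and final objects ([preserves_final]).

    To identify pullbacks over a final object [w] with products, consider a
    diagram [p] on [K] and its restriction [p0] along an injection of [J] in
    [K], such that every simplex of [K] outside [J] ends at a vertex that [p]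
    sends to [w].  The restriction of cones, from [slice p] to [slice p0], then
    has the right lifting property with respect to every inclusion of
    simplicial sets ([restr_lift]).  Hence a cone over [p] is a limit cone if
    and only if its restriction is ([restr_preserves_limit],
    [restr_reflects_limit]).  Take for [K] the cospan and for [J] its two legs:
    [preserves_pullback_final] follows.

    By adjunction, such a lifting problem asks to extend to
    [K * Delta^1 * B] a map given on a simplicial subset outside of which all
    simplices end at points sent to [w].  The extension is built one dimension
    at a time ([extension]): finality of [w] fills each new simplex from its
    boundary, and by the Eilenberg-Zilber lemma ([skel_unique]) the choices for
    distinct simplices do not interact.  The same argument applies in any
    simplicial set: no horn filling is needed. *)

(** * Monotone maps *)

(** Surjectivity of a monotone map; it fails exactly on the boundary. *)
Definition omsurj m n (f : ordmap m n) : Prop := forall k, exists i, f i = k.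

Lemma omsurjVmiss m n (f : ordmap m n) : omsurj f \/ in_boundary f.
Proof.
have [|/existsNP[j hj]] := pselect (omsurj f); first by left.
by right; exists j => i fi; apply: hj; exists i.
Qed.

(** A surjection has a section through any prescribed point. *)
Lemma omsection m n (f : ordmap m n) (i : 'I_m) : omsurj f ->
  exists2 s : ordmap n m, omcomp f s = omid n & s (f i) = i.
Proof.
move=> /choice[s0 hs0].
pose s (k : 'I_n) := if k == f i then i else s0 k.
have fs (k : 'I_n) : f (s k) = k by rewrite /s; case: eqP => [->|].
have s_mono (k l : 'I_n) : k <= l -> s k <= s l.
  move=> kl; rewrite leqNgt; apply/negP => slk.
  have := ommonoP f (ltnW slk); rewrite !fs => lk.
  have klE : k = l by apply/val_inj/anti_leq/andP.
  by rewrite klE ltnn in slk.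
exists (mkom s_mono); last by rewrite /= /s eqxx.
by apply/ordmap_eq/funext => k; exact: fs.
Qed.

Lemma strict_mono_ge n (s : 'I_n -> 'I_n) :
  (forall i j : 'I_n, i < j -> s i < s j) -> forall i : 'I_n, i <= s i.
Proof.
move=> hs [k hk]; elim: k hk => // k IH hk.
have hk' := ltnW hk.
exact: leq_ltn_trans (IH hk') (hs (Ordinal hk') (Ordinal hk) (leqnn _)).
Qed.

(** A section [s] of a surjective monotone endomap [f] is strictly increasing,
    so [k <= s k] for all [k].  Being injective, [s] is also surjective, so a
    section of [s] satisfies the same bound; hence [s k <= k]. *)
Lemma omsurj_id n (f : ordmap n n) : omsurj f -> f = omid n.
Proof.
have sec (g : ordmap n n) : omsurj g -> exists2 s : ordmap n n,
    forall k, g (s k) = k & forall k : 'I_n, k <= s k.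
  move=> g_surj; case: (posnP n) => [n0|n_gt0].
    by exists (omid n) => -[k hk]; exfalso; rewrite n0 in hk.
  have [s gs _] := omsection (Ordinal n_gt0) g_surj.
  have {}gs k : g (s k) = k by exact: (congr1 (fun h : ordmap n n => h k) gs).
  exists s => //; apply: strict_mono_ge => i j ij.
  rewrite ltnNge; apply/negP => /(ommonoP g).
  by rewrite !gs leqNgt ij.
move=> f_surj; have [s fs s_ge] := sec f f_surj.
have s_surj : omsurj s.
  have [t _ ts] := injF_bij (can_inj fs).
  by move=> k; exists (t k); exact: ts.
have [t st t_ge] := sec s s_surj.
apply/ordmap_eq/funext => k /=.
have sk : s k = k.
  by apply/val_inj/anti_leq; rewrite s_ge -{2}(st k) (ommonoP s (t_ge k)).
by rewrite -{1}sk fs.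
Qed.

(** A map that omits [j] factors through the coface omitting [j]. *)
Lemma omface_factor m n (f : ordmap m n.+1) (j : 'I_n.+1) :
  (forall i, f i <> j) -> exists g : ordmap m n, f = omcomp (omface j) g.
Proof.
move=> fj.
have /choice[g hg] (i : 'I_m) : exists k, f i = lift j k.
  case: (unliftP j (f i)) => [k ->|/fj //]; by exists k.
have g_mono (i k : 'I_m) : i <= k -> g i <= g k.
  by move=> /(ommonoP f); rewrite !hg /= leq_bump2.
by exists (mkom g_mono); apply/ordmap_eq/funext.
Qed.

(** The last vertex of the standard simplex. *)
Definition omlast n : ordmap 1 n.+1 := omcst 1 ord_max.

Lemma om1E n (f : ordmap 1 n.+1) : f ord0 = ord_max -> f = omlast n.
Proof. by move=> f0; apply/ordmap_eq/funext => i; rewrite ord1. Qed.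

(** * Extending maps whose new simplices end at a final object *)

(** [g] commutes with the restriction of simplices that satisfy [Q]: it is a
    partial simplicial map defined on [Q], with junk values elsewhere. *)
Definition natural_on (X C : sset) (Q : forall n, X n -> Prop)
    (g : forall n, X n -> C n) : Prop :=
  forall m n (x : X n) (f : ordmap m.+1 n.+1),
    Q n x -> g m (sact x f) = sact (g n x) f.

Section Extension.
Variables (X : sset) (P : forall n, X n -> Prop).
Hypothesis P_closed : forall m n (x : X n) (f : ordmap m.+1 n.+1),
  P x -> P (sact x f).

(** The simplices that are in [P] or are a restriction of a simplex of
    dimension less than [n]. *)
Definition skel (n m : nat) (y : X m) : Prop :=
  P y \/ exists d (x : X d) (f : ordmap m.+1 d.+1), d < n /\ y = sact x f.

Lemma skel_closed n m k (x : X k) (f : ordmap m.+1 k.+1) :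
  skel n x -> skel n (sact x f).
Proof.
move=> [Px|[d [z [h [dn ->]]]]]; first by left; exact: P_closed.
by right; exists d, z, (omcomp h f); rewrite sact_comp.
Qed.

Lemma skel_le n n' m (y : X m) : n <= n' -> skel n y -> skel n' y.
Proof.
move=> nn' [Py|[d [z [h [dn ->]]]]]; [by left|right].
by exists d, z, h; split=> //; exact: leq_trans dn nn'.
Qed.

Lemma skel_dim n m (y : X m) : m < n -> skel n y.
Proof. by move=> mn; right; exists m, y, (omid m.+1); rewrite sact_id. Qed.

Lemma skel_boundary n m (x : X n) (f : ordmap m.+1 n.+1) :
  in_boundary f -> skel n (sact x f).
Proof.
case: n x f => [|n] x f [j hj].
  by case: (hj ord0); rewrite (ord1 (f ord0)) (ord1 j).
have [g ->] := omface_factor hj; rewrite sact_comp.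
by right; exists n, (sact x (omface j)), g.
Qed.

Lemma skel_section n m (x : X n) (f : ordmap m.+1 n.+1) :
  omsurj f -> skel n (sact x f) -> skel n x.
Proof.
move=> f_surj; have [i fi] := f_surj ord0.
have [s fs _] := omsection i f_surj.
move=> /(skel_closed s); by rewrite -sact_comp fs sact_id.
Qed.

(** The Eilenberg-Zilber lemma: outside the skeleton, the presentation of a
    simplex as the restriction of an [n]-simplex is unique. *)
Lemma skel_unique n m (x x' : X n) (f f' : ordmap m.+1 n.+1) :
  ~ skel n (sact x f) -> sact x f = sact x' f' -> x = x' /\ f = f'.
Proof.
move=> nsk xf.
have f_surj : omsurj f.
  by case: (omsurjVmiss f) => // /(skel_boundary x).
have sec (s : ordmap n.+1 m.+1) : omcomp f s = omid n.+1 ->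
    omcomp f' s = omid n.+1.
  move=> fs; case: (omsurjVmiss (omcomp f' s)) => [|/(skel_boundary x')].
    exact: omsurj_id.
  rewrite sact_comp -xf -sact_comp fs sact_id => skx.
  by case: nsk; exact: skel_closed.
split.
  have [s fs _] := omsection ord0 f_surj.
  by rewrite -[LHS]sact_id -fs sact_comp xf -sact_comp (sec _ fs) sact_id.
apply/ordmap_eq/funext => i; have [s fs si] := omsection i f_surj.
by rewrite -{2}si; have /(congr1 (fun g : ordmap _ _ => g (f i))) := sec _ fs.
Qed.

Variables (C : sset) (w : C 0).
Hypothesis w_final : final w.

(** The simplices outside [P] have their last vertex in [P], and [g] sends it
    to [w]. *)
Definition ends_at (g : forall n, X n -> C n) : Prop :=
  forall n (x : X n), ~ P x ->
    P (sact x (omlast n)) /\ g 0 (sact x (omlast n)) = w.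

(** A simplex of dimension [n] outside the skeleton has its boundary in the
    skeleton, so finality of [w] provides its image. *)
Lemma skel_fill (g : forall n, X n -> C n) n (x : X n) :
  natural_on (@skel n) g -> ends_at g ->
  exists z : C n, forall m (f : ordmap m.+1 n.+1),
    skel n (sact x f) -> sact z f = g m (sact x f).
Proof.
move=> g_nat g_end.
have [skx|nskx] := pselect (skel n x).
  by exists (g n x) => m f _; rewrite g_nat.
have {}g_end : P (sact x (omlast n)) /\ g 0 (sact x (omlast n)) = w.
  by apply: g_end => Px; apply: nskx; left.
case: n x g_nat nskx g_end => [|n] x g_nat nskx [Plast glast].
  (* A vertex is its own last vertex, hence is in [P]. *)
  case: nskx; left; have -> : x = sact x (omlast 0); last exact: Plast.
  rewrite -{1}(sact_id x); congr sact; by apply: om1E; apply: val_inj.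
have a_nat m k (t : boundary n.+1 k) (f : ordmap m.+1 k.+1) :
    g m (sact x (sval (sact t f))) = sact (g k (sact x (sval t))) f.
  rewrite -g_nat; first by rewrite -sact_comp.
  exact: skel_boundary (svalP t).
pose a := @SMap (boundary n.+1) C (fun m t => g m (sact x (sval t))) a_nat.
have [|z hz] := w_final (a := a).
  by move=> v v0; rewrite /= (om1E v0).
exists z => m f skf; case: (omsurjVmiss f) => [f_surj|fb].
  by case: nskx; exact: skel_section skf.
exact: (hz m (exist _ f fb)).
Qed.

(** Each simplex outside the skeleton that becomes available is the restriction
    of an [n]-simplex, in a unique way, and is sent to the restriction of the
    filler chosen for it. *)
Lemma skel_step (g : forall n, X n -> C n) n :
  natural_on (@skel n) g -> ends_at g ->
  exists g' : forall n, X n -> C n,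
    [/\ natural_on (@skel n.+1) g', ends_at g' &
        forall m (y : X m), skel n y -> g' m y = g m y].
Proof.
move=> g_nat g_end.
have /choice[Z hZ] (x : X n) := skel_fill x g_nat g_end.
pose cell m (y : X m) := exists xf : X n * ordmap m.+1 n.+1,
  ~ skel n y /\ y = sact xf.1 xf.2.
pose g' m (y : X m) := match pselect (cell m y) with
  | left c => let xf := sval (cid c) in sact (Z xf.1) xf.2
  | right _ => g m y end.
have g'_skel m (y : X m) : skel n y -> g' m y = g m y.
  by move=> sky; rewrite /g'; case: pselect => // c; have [xf []] := c.
have g'_cell m (x : X n) (f : ordmap m.+1 n.+1) :
    g' m (sact x f) = sact (Z x) f.
  have [skf|nskf] := pselect (skel n (sact x f)).
    by rewrite g'_skel // hZ.
  rewrite /g'; case: pselect => [c|[]]; last by exists (x, f).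
  by case: (cid c) => -[x' f'] /= [_ /(skel_unique nskf)[-> ->]].
exists g'; split=> //.
- move=> m k y f [Py|[d [x [h [dn ->]]]]].
    rewrite !g'_skel; [exact: g_nat (or_introl Py)|by left|].
    by apply: skel_closed; left.
  move: dn; rewrite ltnS leq_eqVlt => /orP[/eqP dn|dn].
    case: d / {dn}(esym dn) x h => x h.
    by rewrite -sact_comp !g'_cell sact_comp.
  have skh : skel n (sact x h) by right; exists d, x, h.
  by rewrite !g'_skel //; [exact: g_nat|exact: skel_closed].
- move=> k x nPx; have [Pl <-] := g_end k x nPx; split=> //.
  by apply: g'_skel; left.
Qed.

(** A map defined on [P] extends to [X] when every simplex outside [P] ends at
    a vertex sent to the final object [w]. *)
Lemma extension (g : forall n, X n -> C n) :
  natural_on P g -> ends_at g ->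
  exists G : smap X C, forall n (x : X n), P x -> G n x = g n x.
Proof.
move=> g_nat g_end.
pose good n (h : forall n, X n -> C n) := natural_on (@skel n) h /\ ends_at h.
pose T n := {h : forall n, X n -> C n | good n h}.
have good0 : good 0 g.
  by split=> // m k x f [Px|[d [z [h []]]]] //; exact: g_nat.
have step n (h : T n) : {h' : T n.+1 | forall m (y : X m), skel n y ->
    sval h' m y = sval h m y}.
  apply: cid; case: h => h [h_nat h_end] /=.
  have [h' [h1 h2 h3]] := skel_step h_nat h_end.
  by exists (exist _ h' (conj h1 h2)).
pose fix approx n : T n :=
  if n is n'.+1 then sval (step n' (approx n')) else exist _ g good0.
have approxS n m (y : X m) : skel n y ->
    sval (approx n.+1) m y = sval (approx n) m y.
  exact: (svalP (step n (approx n))).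
have approx_le n n' m (y : X m) : n <= n' -> skel n y ->
    sval (approx n') m y = sval (approx n) m y.
  move=> /subnK <- sky; elim: (n' - n) => // k IH.
  by rewrite addSn approxS ?IH //; apply: skel_le sky; exact: leq_addl.
(* An [m]-simplex is in the skeleton of index [m.+1], where the approximations
   are stationary from rank [m.+1] on. *)
pose G m (y : X m) := sval (approx m.+1) m y.
have G_nat m n (x : X n) (f : ordmap m.+1 n.+1) :
    G m (sact x f) = sact (G n x) f.
  pose N := (maxn m n).+1.
  have mN : m < N by rewrite ltnS leq_maxl.
  have nN : n < N by rewrite ltnS leq_maxr.
  rewrite /G -(approx_le _ N) //; last exact: skel_dim.
  rewrite -(approx_le n.+1 N) //; last exact: skel_dim.
  by apply: (svalP (approx N)).1; exact: skel_dim.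
exists (@SMap X C G G_nat) => n x Px; rewrite /= /G.
by rewrite (approx_le 0) //; left.
Qed.
End Extension.

(** * Restricting cones along a map of diagrams *)

(** A simplex of [Delta^1] is constant or ends at 1. *)
Lemma simplex1P m (t : simplex 1 m) :
  [\/ t = cst0 m.+1, t = cst1 m.+1 | t ord_max = ord_max].
Proof.
have [t1|t1] := eqVneq (t ord_max) ord_max; first by constructor 3.
constructor 1; apply/ordmap_eq/funext => i; apply/val_inj => /=.
have := ommonoP t (leq_ord i : i <= ord_max).
by case: (t ord_max) t1 => -[|[|]] //= ? _; rewrite leqn0 => /eqP.
Qed.

Lemma cst0_neq1 m : cst0 m.+1 <> cst1 m.+1.
Proof. by move=> /(congr1 (fun t : ordmap _ _ => val (t ord0))). Qed.

Lemma slice_eq (K C : sset) (q : smap K C) n (c c' : slice q n) :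
  sval c = sval c' -> c = c'.
Proof. by move: c c' => [c hc] [c' hc'] /= e; exact: eq_exist. Qed.

Section Restriction.
Variables (K J C : sset) (p : smap K C) (p0 : smap J C) (j : smap J K).
Hypothesis p0E : forall n (x : J n), p0 n x = p n (j n x).

Lemma restr_subproof n (c : slice p n) m (x : J m) (t : simplex n m) :
  (sval c).2 m ((j m x, cst0 m.+1), t) = sact (sval c).1 t /\
  (sval c).2 m ((j m x, cst1 m.+1), t) = p0 m x.
Proof. by rewrite p0E; exact: (svalP c m (j m x) t). Qed.

Definition restr_simplex n (c : slice p n) : slice p0 n :=
  exist _ ((sval c).1, precomp (sprod_map j (sid (simplex 1))) (sval c).2)
    (@restr_subproof n c).

Lemma restr_nat m n (c : slice p n) (f : ordmap m.+1 n.+1) :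
  restr_simplex (sact c f) = sact (restr_simplex c) f.
Proof. by apply: slice_eq; congr pair; exact: smap_eq. Qed.

(** Precomposition of cones over [p] with [j]. *)
Definition restr : smap (slice p) (slice p0) :=
  @SMap (slice p) (slice p0) restr_simplex restr_nat.
End Restriction.

Section RestrictionLift.
Variables (K J C : sset) (p : smap K C) (p0 : smap J C) (j : smap J K).
Hypothesis p0E : forall n (x : J n), p0 n x = p n (j n x).
Hypothesis j_inj : forall n, injective (j n).
Variable w : C 0.
Hypothesis w_final : final w.
Hypothesis ends : forall n (k : K n),
  (forall x, j n x <> k) -> p 0 (sact k (omlast n)) = w.

Notation r := (restr p0E).

Section Lift.
Variables (B : sset) (A : forall n, B n -> Prop).
Hypothesis A_closed : forall m n (b : B n) (f : ordmap m.+1 n.+1),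
  A b -> A (sact b f).
Variables (f : smap B (slice p0)) (g : smap (ssub A_closed) (slice p)).
Hypothesis rg : forall n (b : ssub A_closed n), r n (g n b) = f n (sval b).

Let X := sprod (sprod K (simplex 1)) B.

(* The locus where a lift is prescribed, transposed to [(K * Delta^1) * B]: by
   [f] on [J] and at the apex of the cones, by [p] at their base, and by [g]
   over [A]. *)
Let P n (x : X n) : Prop :=
  [\/ exists y, j n y = x.1.1, x.1.2 = cst0 n.+1, x.1.2 = cst1 n.+1 | A x.2].

Let P_closed m n (x : X n) (h : ordmap m.+1 n.+1) : P x -> P (sact x h).
Proof.
move=> [[y jy]|x0|x1|Ax].
- by constructor 1; exists (sact y h); rewrite smap_nat jy.
- by constructor 2; rewrite /= x0.
- by constructor 3; rewrite /= x1.
- by constructor 4; exact: A_closed.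
Qed.

(* The value of the adjoint of a map to a slice: evaluate the cone of the
   [m]-simplex at the universal [m]-simplex. *)
Let ev L (q : smap L C) m (l : sprod L (simplex 1) m) (c : slice q m) : C m :=
  (sval c).2 m (l, omid m.+1).

Let ev_nat L (q : smap L C) m n (l : sprod L (simplex 1) n) (c : slice q n)
    (h : ordmap m.+1 n.+1) : ev (sact l h) (sact c h) = sact (ev l c) h.
Proof. by rewrite /ev -smap_nat. Qed.

Let ev_fst L (q : smap L C) m (l : L m) (c : slice q m) :
  ev (l, cst0 m.+1) c = (sval c).1.
Proof. by rewrite /ev (svalP c m l (omid m.+1)).1 sact_id. Qed.

Let ev_snd L (q : smap L C) m (l : L m) (c : slice q m) :
  ev (l, cst1 m.+1) c = q m l.
Proof. by rewrite /ev (svalP c m l (omid m.+1)).2. Qed.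

Let rg1 m (b : ssub A_closed m) : (sval (g m b)).1 = (sval (f m (sval b))).1.
Proof. by rewrite -rg. Qed.

(* The prescribed values agree where the four cases of [P] overlap. *)
Let value m (x : X m) : C m :=
  match pselect (exists y, j m y = x.1.1) with
  | left e => ev (sval (cid e), x.1.2) (f m x.2)
  | right _ =>
    match pselect (A x.2) with
    | left a => ev x.1 (g m (exist _ x.2 a))
    | right _ => if pselect (x.1.2 = cst0 m.+1) then (sval (f m x.2)).1
                 else p m x.1.1
    end
  end.

Let value_J m y t (b : B m) : value ((j m y, t), b) = ev (y, t) (f m b).
Proof.
rewrite /value /=; case: pselect => [e|[]]; last by exists y.
by case: (cid e) => y' /= /j_inj ->.
Qed.

Let value_A m (l : sprod K (simplex 1) m) (b : ssub A_closed m) :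
  value (l, sval b) = ev l (g m b).
Proof.
rewrite /value /=; case: pselect => [e|_].
  case: (cid e) => y /= jy; rewrite -rg /ev /=.
  by rewrite jy; case: l {e jy}.
case: pselect => [a|[]]; last exact: (svalP b).
by congr (ev l (g m _)); case: b a => b a a'; exact: eq_exist.
Qed.

Let value_0 m (k : K m) (b : B m) :
  value ((k, cst0 m.+1), b) = (sval (f m b)).1.
Proof.
rewrite /value /=; case: pselect => [e|_]; first by rewrite ev_fst.
case: pselect => [a|_]; first by rewrite ev_fst rg1.
by case: pselect.
Qed.

Let value_1 m (k : K m) (b : B m) : value ((k, cst1 m.+1), b) = p m k.
Proof.
rewrite /value /=; case: pselect => [e|_].
  by rewrite ev_snd; case: (cid e) => y /= <-; rewrite p0E.
case: pselect => [a|_]; first by rewrite ev_snd.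
by case: pselect => // e; case: (cst0_neq1 (esym e)).
Qed.

Let value_nat : natural_on P value.
Proof.
move=> m n [[k t] b] h [[/= y <-]|/= ->|/= ->|/= Ab].
- rewrite -[LHS]/(value ((sact (j n y) h, sact t h), sact b h)) -(smap_nat j).
  by rewrite !value_J smap_nat -ev_nat.
- rewrite -[LHS]/(value ((sact k h, cst0 m.+1), sact b h)).
  by rewrite !value_0 smap_nat.
- rewrite -[LHS]/(value ((sact k h, cst1 m.+1), sact b h)).
  by rewrite !value_1 smap_nat.
- rewrite (value_A (k, t) (exist _ b Ab)) -ev_nat -smap_nat.
  exact: value_A (sact (exist _ b Ab : ssub A_closed n) h).
Qed.

Let value_ends : ends_at P w value.
Proof.
move=> n [[k t] b] nP.
have kJ x : j n x <> k by move=> jx; apply: nP; constructor 1; exists x.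
(* Otherwise [k] ends at a vertex over [w], and [t] ends at the base. *)
have [t0|t1|tl] := simplex1P t.
- by case: nP; constructor 2.
- by case: nP; constructor 3.
have tE : omcomp t (omlast n) = cst1 1.
  by apply/ordmap_eq/funext => i; exact: tl.
split; first by constructor 3.
by rewrite /= tE value_1 ends.
Qed.

(** Restriction of cones lifts on the right against the inclusion of [A] in
    [B]. *)
Lemma restr_lift : exists h : smap B (slice p),
  (forall n (b : B n), r n (h n b) = f n b) /\
  (forall n (b : ssub A_closed n), h n (sval b) = g n b).
Proof.
have [G GE] := extension P_closed w_final value_nat value_ends.
have G_J m y t (b : B m) : G m ((j m y, t), b) = ev (y, t) (f m b).
  by rewrite GE ?value_J //; constructor 1; exists y.
have G_0 m k (b : B m) : G m ((k, cst0 m.+1), b) = (sval (f m b)).1.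
  by rewrite GE ?value_0 //; constructor 2.
have G_1 m k (b : B m) : G m ((k, cst1 m.+1), b) = p m k.
  by rewrite GE ?value_1 //; constructor 3.
have G_A m l (b : ssub A_closed m) : G m (l, sval b) = ev l (g m b).
  by rewrite GE ?value_A //; constructor 4; exact: (svalP b).
have cone_nat n (b : B n) m k (ls : sprod (sprod K (simplex 1)) (simplex n) k)
    (s : ordmap m.+1 k.+1) :
    G m ((sact ls s).1, sact b (sact ls s).2) =
    sact (G k (ls.1, sact b ls.2)) s.
  by rewrite -smap_nat /= sact_comp.
pose cone n (b : B n) : Fun (sprod K (simplex 1)) C n :=
  @SMap (sprod (sprod K (simplex 1)) (simplex n)) C _ (@cone_nat n b).
have coneP n (b : B n) m (k : K m) (t : simplex n m) :
    cone n b m ((k, cst0 m.+1), t) = sact (sval (f n b)).1 t /\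
    cone n b m ((k, cst1 m.+1), t) = p m k.
  by rewrite /= G_0 G_1 smap_nat.
pose h0 n (b : B n) : slice p n :=
  exist _ ((sval (f n b)).1, cone n b) (@coneP n b).
have h0_nat m n (b : B n) (s : ordmap m.+1 n.+1) :
    h0 m (sact b s) = sact (h0 n b) s.
  apply: slice_eq; rewrite /= smap_nat; congr pair.
  by apply: smap_eq => k [l t] /=; rewrite sact_comp.
exists (@SMap B (slice p) h0 h0_nat); split=> n b; apply: slice_eq.
- rewrite [RHS]surjective_pairing; congr pair.
  apply: smap_eq => m [[y t] s] /=; rewrite G_J.
  by rewrite smap_nat.
- rewrite [RHS]surjective_pairing; congr pair; first by rewrite -rg1.
  apply: smap_eq => m [l s] /=.
  have := G_A m l (sact b s); rewrite /= => ->.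
  by rewrite smap_nat.
Qed.
End Lift.

Lemma ptmap0 : ptmap 0 = omid 1.
Proof. by apply/ordmap_eq/funext => i; apply/esym/ord1. Qed.

(** Lift against the boundary inclusion, over the filler found in
    [slice p0]. *)
Lemma restr_reflects_limit (c : slice p 0) : limit_cone (r 0 c) -> limit_cone c.
Proof.
move=> rc_final n a a_last.
have [|z hz] := rc_final n (scomp r a).
  by move=> v v0; rewrite /= a_last.
pose f_map := @SMap (simplex n.+1) (slice p0) (fun m t => sact z t)
  (fun m k t s => sact_comp z t s).
have ra m (b : boundary n.+1 m) : r m (a m b) = f_map m (sval b).
  by rewrite -[RHS]/(sact z (sval b)); exact/esym/hz.
have [h [_ hA]] := restr_lift ra.
exists (h n.+1 (omid n.+2)) => m t.
by rewrite -smap_nat -hA.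
Qed.

(** Lift against the inclusion of the last vertex in the boundary: a boundary in
    [slice p0] that ends at [r c] comes from one in [slice p] that ends at
    [c]. *)
Lemma restr_preserves_limit (c : slice p 0) :
  limit_cone c -> limit_cone (r 0 c).
Proof.
move=> c_final n a a_last.
pose A m (b : boundary n.+1 m) := sval b = omcst m.+1 ord_max.
have A_closed m k (b : boundary n.+1 k) (s : ordmap m.+1 k.+1) :
    A k b -> A m (sact b s) by rewrite /A /= => ->.
have g_nat m k (b : ssub A_closed k) (s : ordmap m.+1 k.+1) :
    sact c (ptmap m) = sact (sact c (ptmap k)) s.
  by rewrite -sact_comp.
pose g := @SMap (ssub A_closed) (slice p) (fun m _ => sact c (ptmap m)) g_nat.
have rg m (b : ssub A_closed m) : r m (g m b) = a m (sval b).
  case: b => b Ab; rewrite -[LHS]/(r m (sact c (ptmap m))) smap_nat.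
  have lastB : in_boundary (omlast n.+1 : simplex n.+1 0).
    by exists ord0 => i /(congr1 val).
  rewrite -(a_last (exist _ (omlast n.+1) lastB)) // -smap_nat.
  congr (a m _); case: b Ab => x hx /= Ab; refine (eq_exist _ _ _).
  by rewrite (Ab : x = _).
have [h [hr hA]] := restr_lift rg.
have [|z hz] := c_final n h.
  move=> v v0; rewrite (hA 0 (exist _ v (om1E v0))).
  by rewrite -[LHS]/(sact c (ptmap 0)) ptmap0 sact_id.
exists (r n.+1 z) => m t.
by rewrite -smap_nat (hz m t) hr.
Qed.
End RestrictionLift.

(** * Pullbacks over a final object are products *)

Section EmptyDiagram.
Variables (K C : sset) (p : smap K C).
Hypothesis K_empty : forall n, K n -> False.

Let to_empty n : Fun (sprod K (simplex 1)) C n :=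
  @SMap (sprod (sprod K (simplex 1)) (simplex n)) C
    (fun m l => False_rect _ (K_empty l.1.1))
    (fun m k l s => False_ind _ (K_empty l.1.1)).

Let to_empty_eq n (h : Fun (sprod K (simplex 1)) C n) : h = to_empty n.
Proof. by apply: smap_eq => m [[l t] s]; case: (K_empty l). Qed.

Let empty_cone n (y : C n) : slice p n :=
  exist _ (y, to_empty n) (fun m k t => False_ind _ (K_empty k)).

Let empty_coneE n (c : slice p n) : c = empty_cone (sval c).1.
Proof.
by apply: slice_eq => /=; rewrite -(to_empty_eq (sval c).2); case: (sval c).
Qed.

(** A cone over the empty diagram is a limit cone when its apex is final. *)
Lemma limit_cone_empty (c : slice p 0) : limit_cone c <-> final (sval c).1.
Proof.
have cone_nat m n (y : C n) (f : ordmap m.+1 n.+1) :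
    empty_cone (sact y f) = sact (empty_cone y) f.
  by rewrite [RHS]empty_coneE.
split=> c_final n a a_last.
- pose a' := @SMap (boundary n.+1) (slice p) (fun m t => empty_cone (a m t))
    (fun m k t f => etrans (congr1 (@empty_cone m) (smap_nat a t f))
                           (cone_nat m k (a k t) f)).
  have [|y hy] := c_final n a'.
    by move=> v v0; rewrite [RHS]empty_coneE /= a_last.
  exists (sval y).1 => m t.
  exact: (congr1 (fun d : slice p m => (sval d).1) (hy m t)).
- pose a' := @SMap (boundary n.+1) C (fun m t => (sval (a m t)).1)
    (fun m k t f => congr1 (fun d : slice p m => (sval d).1) (smap_nat a t f)).
  have [|y hy] := c_final n a'.
    by move=> v v0; rewrite /= a_last.
  exists (empty_cone y) => m t.
  by rewrite [RHS]empty_coneE -cone_nat hy.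
Qed.
End EmptyDiagram.

(** A final object is a product of the empty family. *)
Lemma preserves_final C D (L : smap C D) (x : C 0) :
  preserves_finite_products L -> final x -> final (L 0 x).
Proof.
move=> L_products x_final.
have empty n : disc void n -> False by [].
pose p := @SMap (disc void) C (fun n v => False_rect _ (empty n v))
  (fun m n v f => False_ind _ (empty n v)).
pose h := @SMap (sprod (sprod (disc void) (simplex 1)) (simplex 0)) C
  (fun n v => False_rect _ (empty n v.1.1))
  (fun m n v f => False_ind _ (empty n v.1.1)).
pose c : slice p 0 := exist _ (x, h : Fun _ C 0)
  (fun m k t => False_ind _ (empty m k)).
have /L_products : limit_cone c by apply/(limit_cone_empty empty).
by move/(limit_cone_empty empty).
Qed.

(** The objects (1,0) and (0,1) of the cospan, as degenerate [n]-simplices. *)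
Definition leg (n : nat) (b : bool) : sprod (simplex 1) (simplex 1) n :=
  if b then (cst1 n.+1, cst0 n.+1) else (cst0 n.+1, cst1 n.+1).

Lemma leg_cospan n (b : bool) (i : 'I_n.+1) :
  (leg n b).1 i = ord_max \/ (leg n b).2 i = ord_max.
Proof. by case: b; [left|right]. Qed.

Lemma leg_nat m n (b : bool) (f : ordmap m.+1 n.+1) :
  leg m b = sact (leg n b) f.
Proof. by case: b. Qed.

(** The two legs of the cospan, as a discrete diagram in it. *)
Definition legs : smap (disc bool) cospan :=
  @SMap (disc bool) cospan (fun n b => exist _ (leg n b) (@leg_cospan n b))
    (fun m n b f => eq_exist _ _ (leg_nat b f)).

Lemma legs_inj n : injective (legs n).
Proof.
by move=> [] [] // /(congr1 (fun k : cospan n => val ((sval k).1 ord0))).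
Qed.

(** A simplex of the cospan that is not in the legs ends at the corner. *)
Lemma legs_ends n (k : cospan n) : (forall b, legs n b <> k) ->
  sact (sval k) (omlast n) = (cst1 1, cst1 1).
Proof.
case: k => [[s t] st] kJ /=.
have cstE (u : ordmap n.+1 2) : u ord_max <> ord_max -> u = cst0 n.+1.
  by move=> ul; case: (simplex1P u) => // uE; case: ul; rewrite uE.
have lastE (u : ordmap n.+1 2) :
    u ord_max = ord_max -> omcomp u (omlast n) = cst1 1.
  by move=> ul; apply/ordmap_eq/funext => i; exact: ul.
have neq i : cst0 n.+1 i <> ord_max by move=> /(congr1 val).
have cst1E (u : ordmap n.+1 2) : (forall i, u i = ord_max) -> u = cst1 n.+1.
  by move=> ul; apply/ordmap_eq/funext => i; exact: ul.
congr pair; apply: lastE; apply: contrapT => /cstE uE.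
- case: (kJ false); refine (eq_exist _ _ _); rewrite uE; congr pair.
  by apply/esym/cst1E => i; case: (st i) => //=; rewrite uE => /neq.
- case: (kJ true); refine (eq_exist _ _ _); rewrite uE; congr pair.
  by apply/esym/cst1E => i; case: (st i) => //=; rewrite uE => /neq.
Qed.

(** A functor that preserves finite products preserves pullback squares over a
    final object. *)
Lemma preserves_pullback_final C D (L : smap C D)
    (q : smap (sprod (simplex 1) (simplex 1)) C) :
  preserves_finite_products L -> final (q 0 (cst1 1, cst1 1)) ->
  is_pullback q -> is_pullback (scomp L q).
Proof.
move=> L_products w_final [c [c_cone c_lim]].
set p := scomp q _ in c c_cone c_lim.
pose p0 := scomp p legs.
have ends n (k : cospan n) : (forall b, legs n b <> k) ->
    p 0 (sact k (omlast n)) = q 0 (cst1 1, cst1 1).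
  by move=> /legs_ends <-.
have p0E n (b : disc bool n) : p0 n b = p n (legs n b) by [].
have /L_products Lc_lim :=
  restr_preserves_limit (p0E := p0E) legs_inj w_final ends c_lim.
pose p' := scomp (scomp L q) (sincl _ : smap cospan _).
(* [p'] is only extensionally equal to [scomp L p]; restriction along the
   identity transports cones from one to the other. *)
have p'E n (k : cospan n) : p' n k = scomp L p n (sid _ n k) by [].
exists (restr p'E 0 (slice_map L p 0 c)); split.
  by rewrite /cone_is /= c_cone; congr pair; exact: smap_eq.
have Lp0E n (b : disc bool n) : scomp L p0 n b = p' n (legs n b) by [].
have Lends n (k : cospan n) : (forall b, legs n b <> k) ->
    p' 0 (sact k (omlast n)) = L 0 (q 0 (cst1 1, cst1 1)).
  by move=> /ends <-.
apply: (restr_reflects_limit (p0E := Lp0E) legs_inj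
  (preserves_final L_products w_final) Lends).
set d := slice_map L p0 0 _ in Lc_lim.
suff -> : restr Lp0E 0 (restr p'E 0 (slice_map L p 0 c)) = d by [].
by apply: slice_eq; congr pair; exact: smap_eq.
Qed.

Lemma scompA A B C D (h : smap C D) (g : smap B C) (f : smap A B) :
  scomp h (scomp g f) = scomp (scomp h g) f.
Proof. exact: smap_eq. Qed.

Lemma chain_eq A n ob hom hom_id hom_id' hom_cmp hom_cmp' :
  @Chain A n ob hom hom_id hom_cmp = @Chain A n ob hom hom_id' hom_cmp'.
Proof.
rewrite (Prop_irrelevance hom_id hom_id').
by rewrite (Prop_irrelevance hom_cmp hom_cmp').
Qed.

Lemma square_corner A (x y z w : Ob A) (f : Hom x y) (g : Hom x z)
    (h : Hom y w) (k : Hom z w) (e : cmp h f = cmp k g) :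
  square e 0 (cst1 1, cst1 1) = vertex w.
Proof. exact: chain_eq. Qed.

(** The squares of the groupoid condition have corner [G_0], which is final. *)
Lemma preserves_group_object C D (L : smap C D) (G : simplicial_object C) :
  preserves_finite_products L -> group_object G -> group_object (scomp L G).
Proof.
move=> L_products [G_gpd G0_final]; split; last first.
  exact: (preserves_final L_products G0_final).
move=> n p q a b u v e a_inj b_inj ab_cover ab_meet.
rewrite -scompA; apply: preserves_pullback_final => //.
  by rewrite -[X in final X]/(G 0 (square _ 0 (cst1 1, cst1 1))) square_corner.
exact: G_gpd.
Qed.

(** * Images of actions and bundles *)

Section Images.
Variables (C D : sset) (L : smap C D).

Lemma src_map (e : C 1) : L 0 (src e) = src (L 1 e).
Proof. exact: smap_nat. Qed.

Lemma tgt_map (e : C 1) : L 0 (tgt e) = tgt (L 1 e).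
Proof. exact: smap_nat. Qed.

Lemma idedge_map (x : C 0) : L 1 (idedge x) = idedge (L 0 x).
Proof. exact: smap_nat. Qed.

Lemma composite_map (f g h : C 1) :
  composite f g h -> composite (L 1 f) (L 1 g) (L 1 h).
Proof.
by move=> [s [sf sg sh]]; exists (L 2 s); split; rewrite -smap_nat ?sf ?sg ?sh.
Qed.

Lemma homotopic_map (f g : C 1) : homotopic f g -> homotopic (L 1 f) (L 1 g).
Proof. by move=> /composite_map; rewrite idedge_map tgt_map. Qed.

Lemma equivalence_map (f : C 1) : equivalence f -> equivalence (L 1 f).
Proof.
move=> [g /composite_map fg /composite_map gf]; exists (L 1 g).
  by move: fg; rewrite idedge_map src_map.
by move: gf; rewrite idedge_map tgt_map.
Qed.

Lemma postcomp_fob K (F : smap K C) : postcomp L (fob F) = fob (scomp L F).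
Proof. exact: smap_eq. Qed.

Hypothesis L_products : preserves_finite_products L.

Lemma is_product_map (I : finType) (x : C 0) (y : I -> C 0) (e : I -> C 1) :
  is_product x y e ->
  is_product (L 0 x) (fun i => L 0 (y i)) (fun i => L 1 (e i)).
Proof.
move=> [p [h [c [py he c_cone c_lim]]]].
exists (scomp L p), (scomp L h), (slice_map L p 0 c); split.
- by move=> i /=; rewrite py.
- by move=> i /=; rewrite he.
- by rewrite /cone_is /= c_cone postcomp_fob.
- exact: L_products.
Qed.

Lemma is_action_map (G : simplicial_object C) (P : C 0)
    (X : simplicial_object C) :
  is_action G P X -> is_action (scomp L G) (L 0 P) (scomp L X).
Proof.
move=> [G_group [pr [q [phi [lev0 pr0 prod d1 s0_pr s0_q phi_src phi_tgt phiP
  dlast_pr dlast_q d0_pr d0_q]]]]].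
split; first exact: preserves_group_object.
exists (fun n => L 1 (pr n)), (fun n i => L 1 (q n i)), (postcomp L phi); split.
- exact: congr1 lev0.
- by rewrite pr0 idedge_map.
- move=> n; have := is_product_map (prod n); congr is_product.
    by apply/funext => -[].
  by apply/funext => -[].
- exact: homotopic_map d1.
- by rewrite -idedge_map; exact: composite_map s0_pr.
- have [t [w [t_src t_tgt tw s0w]]] := s0_q.
  exists (L 1 t), (L 1 w); split.
  + by rewrite -src_map t_src.
  + by rewrite -tgt_map t_tgt.
  + exact: composite_map tw.
  + exact: composite_map s0w.
- by rewrite -postcomp_fob -phi_src; exact: smap_eq.
- by rewrite -postcomp_fob -phi_tgt; exact: smap_eq.
- move=> n i; exact: composite_map (phiP n i).
- move=> n; exact: composite_map (dlast_pr n).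
- move=> n i; exact: composite_map (dlast_q n i).
- move=> n; have [r [w [h1 h2 h3 h4]]] := d0_pr n.
  exists (L 1 r), (L 1 w); split.
  + exact: composite_map h1.
  + exact: composite_map h2.
  + exact: composite_map h3.
  + exact: composite_map h4.
- move=> n i; exact: composite_map (d0_q n i).
Qed.

Lemma underlying_map (Y : augmented_object C) :
  underlying (scomp L Y) = scomp L (underlying Y).
Proof. exact: smap_eq. Qed.

Lemma is_action_over_map (G : simplicial_object C) (P B : C 0) (p : C 1)
    (Y : augmented_object C) :
  is_action_over G P B p Y ->
  is_action_over (scomp L G) (L 0 P) (L 0 B) (L 1 p) (scomp L Y).
Proof.
move=> [act <- <-]; split=> //.
by rewrite underlying_map; exact: is_action_map.
Qed.

Lemma realisation_equivalence_map (Y : augmented_object C) :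
  preserves_geometric_realisations L ->
  realisation_equivalence Y -> realisation_equivalence (scomp L Y).
Proof.
move=> L_real [c [b [e [c_colim b_cone ec eb e_eq]]]].
rewrite /realisation_equivalence underlying_map.
pose F := coslice_map L (underlying Y).
exists (F 0 c), (F 0 b), (F 1 e); split.
- exact: L_real.
- by rewrite /cocone_is /= b_cone postcomp_fob scompA.
- by rewrite -ec; apply/esym/smap_nat.
- by rewrite -eb; apply/esym/smap_nat.
- exact: equivalence_map e_eq.
Qed.
End Images.

Theorem theorem3p32 (H H' : sset) (topos_H : infinity_topos H)
    (topos_H' : infinity_topos H') (L : smap H H')
    (L_realisations : preserves_geometric_realisations L)
    (L_products : preserves_finite_products L)
    (G : simplicial_object H) (group_G : group_object G) :
  (forall (P B : H 0) (p : H 1) (Y : augmented_object H),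
     is_action_over G P B p Y ->
     is_action_over (scomp L G) (L 0 P) (L 0 B) (L 1 p) (scomp L Y)) /\
  (forall (P B : H 0) (p : H 1) (Y : augmented_object H),
     is_principal_bundle G P B p Y ->
     is_principal_bundle (scomp L G) (L 0 P) (L 0 B) (L 1 p) (scomp L Y)).
Proof.
split=> P B p Y; first exact: is_action_over_map.
move=> [act real]; split; first exact: is_action_over_map.
exact: realisation_equivalence_map.
Qed.
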